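(* Let $n\in\mathbb{N}$, let $E_0,\dots,E_{n-1}$ be pairwise disjoint sets with $E=\bigcup_{i<n}E_i$, let $U_i$ be a uniform matroid on $E_i$ for each $i<n$, let $N=\bigoplus_{i<n}U_i$, and let $M$ be a matroid on $E$. Assume that there is no nonempty set $W\subseteq E$ which is a union of some of the sets $E_i$ such that the restriction $M\upharpoonright W$ has a base that is independent in $N$. Then for every $J\in\mathcal{I}_M\cap\mathcal{I}_N$ there exists a base $B$ of $N$ that is independent in $M$ and satisfies $J\subseteq\mathsf{span}_M(B)$.
   Context: Matroids are possibly infinite (B-)matroids: a matroid on $E$ is a pair $(E,\mathcal{I})$ with $\mathcal{I}\subseteq\mathcal{P}(E)$ such that (i) $\varnothing\in\mathcal{I}$; (ii) $\mathcal{I}$ is closed under subsets; (iii) for all $I,J\in\mathcal{I}$ with $J$ $\subseteq$-maximal in $\mathcal{I}$ and $I$ not maximal, there is $e\in J\setminus I$ with $I\cup\{e\}\in\mathcal{I}$; (iv) for every $X\subseteq E$, every $I\in\mathcal{I}$ with $I\subseteq X$ extends to a $\subseteq$-maximal element of $\{J\in\mathcal{I}:J\subseteq X\}$. Maximal independent sets are bases; $\mathcal{I}_M$ denotes the set of independent sets of $M$. The restriction $M\upharpoonright W$ is the matroid on $W$ whose independent sets are the $M$-independent subsets of $W$. For $X\subseteq E$, $\mathsf{span}_M(X)$ consists of $X$ together with all $e\in E\setminus X$ such that $B_X\cup\{e\}$ is dependent in $M$, where $B_X$ is a maximal $M$-independent subset of $X$. A matroid $(E,\mathcal{I})$ is uniform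 if for every $I\in\mathcal{I}$, $e\in I$ and $f\in E\setminus I$ we have $(I\setminus\{e\})\cup\{f\}\in\mathcal{I}$. The direct sum $\bigoplus_i U_i$ is the matroid on $\bigcup_i E_i$ in which $I$ is independent iff $I\cap E_i$ is independent in $U_i$ for all $i$. *)

(* Defs.v *)
From mathcomp Require Import all_boot.
From mathcomp Require Import boolp classical_sets.

Set Implicit Arguments.
Unset Strict Implicit.
Unset Printing Implicit Defensive.

Local Open Scope classical_set_scope.

Definition maximal_in (T : Type) (A : set (set T)) (B : set T) : Prop :=
  A B /\ forall C, A C -> B `<=` C -> C `<=` B.

(* Possibly infinite matroids on a ground set E inside an ambient type T. *)
Record matroid (T : Type) (E : set T) := Matroid {
  indep : set (set T);
  indep_ground : forall I, indep I -> I `<=` E;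
  indep_set0 : indep set0;
  indep_subset : forall I J, indep J -> I `<=` J -> indep I;
  indep_augment : forall I J, indep I -> maximal_in indep J ->
    ~ maximal_in indep I ->
    exists e, (J `\` I) e /\ indep (I `|` [set e]);
  indep_extend : forall X I, X `<=` E -> indep I -> I `<=` X ->
    exists J, maximal_in [set K | indep K /\ K `<=` X] J /\ I `<=` J }.

Definition base (T : Type) (E : set T) (M : matroid E) (B : set T) : Prop :=
  maximal_in (indep M) B.

(* By span_indep_choice below, the choice of the maximal independent subset B
   of X is immaterial. *)
Definition span (T : Type) (E : set T) (M : matroid E) (X : set T) : set T :=
  X `|` [set e | (E `\` X) e /\
    exists B, maximal_in [set I | indep M I /\ I `<=` X] B /\
      ~ indep M (B `|` [set e])].

Definition uniform (T : Type) (E : set T) (M : matroid E) : Prop :=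
  forall I e f, indep M I -> I e -> (E `\` I) f ->
    indep M ((I `\ e) `|` [set f]).

Lemma not_maximal_in (T : Type) (A : set (set T)) (B : set T) :
  A B -> ~ maximal_in A B -> exists C x, [/\ A C, B `<=` C, C x & ~ B x].
Proof.
move=> AB nB; apply: contrapT => nC; apply: nB; split=> // C AC BC x Cx.
by apply: contrapT => nBx; apply: nC; exists C, x.
Qed.

Section Restriction.
Variables (T : Type) (E : set T) (M : matroid E) (W : set T).

Definition restr_indep : set (set T) := [set I | indep M I /\ I `<=` W].

Lemma restr_ground I : restr_indep I -> I `<=` W.
Proof. by case. Qed.

Lemma restr_set0 : restr_indep set0.
Proof. by split; [exact: indep_set0|move=> x]. Qed.

Lemma restr_subset I J : restr_indep J -> I `<=` J -> restr_indep I.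
Proof.
move=> [iJ JW] IJ; split; first exact: indep_subset iJ IJ.
by move=> x /IJ /JW.
Qed.

Lemma restr_augment I J : restr_indep I -> maximal_in restr_indep J ->
  ~ maximal_in restr_indep I ->
  exists e, (J `\` I) e /\ restr_indep (I `|` [set e]).
Proof.
move=> rI [[iJ JW] mJ] nI; apply: contrapT => nope.
have aug e : J e -> ~ I e -> ~ indep M (I `|` [set e]).
  move=> Je nIe ie; apply: nope; exists e; split=> //; split=> //.
  by move=> y [/(proj2 rI)//|->]; exact: JW.
have [K [x [[iK KW] IK Kx nIx]]] := not_maximal_in rI nI.
have JD f : W f -> indep M (J `|` [set f]) -> J f.
  move=> Wf iJf; apply: (mJ (J `|` [set f])); last by right.
  - by split=> // y [/JW//|->].
  - by move=> y; left.
have full (L : set T) : indep M L -> L `<=` E by exact: indep_ground.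
have [B [[[iB _] mB] JB]] := @indep_extend _ _ M E J (fun x h => h) iJ (full _ iJ).
have bB : maximal_in (indep M) B.
  by split=> // C iC; apply: mB; split=> //; exact: full.
pose Ix := I `|` [set x].
have iIx : indep M Ix by apply: indep_subset iK _; rewrite /Ix => y [/IK//|->].
have IxW y : Ix y -> W y by rewrite /Ix => -[/(proj2 rI)//|->]; exact: KW.
have [L [[[iL LX] mL] IxL]] : exists L,
    maximal_in [set K | indep M K /\ K `<=` Ix `|` (B `\` W)] L /\ Ix `<=` L.
  apply: indep_extend => // y.
  by case=> [/(full _ iIx)//|[By _]]; exact: full iB _ By.
have bL : maximal_in (indep M) L.
  apply: contrapT => nL.
  have [e [[Be nLe] ie]] := indep_augment iL bB nL.
  have [We|nWe] := pselect (W e).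
    apply: (aug e).
    - apply: JD => //; apply: indep_subset iB _ => y [/JB//|->//].
    - by move=> Ie; apply: nLe; apply: IxL; left.
    - by apply: indep_subset ie _ => y [Iy|->]; [left; apply: IxL; left|right].
  apply: nLe; apply: (mL (L `|` [set e])); last by right.
  - by split=> // y [/LX//|->]; right.
  - by move=> y; left.
pose C := L `\` W.
have CB y : C y -> B y by rewrite /C => -[/LX [/IxW//|[]]].
have iIC : indep M (I `|` C).
  by apply: indep_subset iL _ => y [Iy|[]//]; apply: IxL; left.
have nIC : ~ maximal_in (indep M) (I `|` C).
  move=> [_ /(_ L iL)] h.
  have : (I `|` C) x.
    apply: h; last by apply: IxL; right.
    by move=> y [Iy|[]//]; apply: IxL; left.
  by case=> // -[_]; apply; exact: KW.
have [e [[Be nICe] ie]] := indep_augment iIC bB nIC.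
have nJe : ~ J e.
  move=> Je; apply: (aug e) => //; first by move=> Ie; apply: nICe; left.
  by apply: indep_subset ie _ => y [Iy|->]; [left; left|right].
have nWe : ~ W e.
  move=> We; apply: nJe; apply: JD => //.
  by apply: indep_subset iB _ => y [/JB//|->//].
have iJC : indep M (J `|` C) by apply: indep_subset iB _ => y [/JB//|/CB].
have nJC : ~ maximal_in (indep M) (J `|` C).
  move=> [_ /(_ B iB)] h.
  have : (J `|` C) e by apply: h => // y [/JB//|/CB].
  by case=> // Ce; apply: nICe; right.
have [f [[Lf nJCf] jf]] := indep_augment iJC bL nJC.
have [Wf|nWf] := pselect (W f); last by apply: nJCf; right.
apply: nJCf; left; apply: JD => //.
by apply: indep_subset jf _ => y [Jy|->]; [left; left|right].
Qed.

Lemma restr_extend X I : X `<=` W -> restr_indep I -> I `<=` X ->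
  exists J, maximal_in [set K | restr_indep K /\ K `<=` X] J /\ I `<=` J.
Proof.
move=> XW [iI IW] IX.
have [|||J [[[iJ JX] mJ] IJ]] := @indep_extend _ _ M (X `&` E) I.
- by move=> y [].
- exact: iI.
- by move=> y Iy; split; [exact: IX|exact: indep_ground iI _ Iy].
exists J; split=> //; split.
  by split; [split=> // y /JX [/XW]|move=> y /JX []].
move=> C [[iC CW] CX]; apply: mJ; split=> // y Cy; split; first exact: CX.
exact: indep_ground iC _ Cy.
Qed.

Definition restrict : matroid W := Matroid restr_ground restr_set0
  restr_subset restr_augment restr_extend.

End Restriction.

Section DirectSum.
Variables (T K : Type) (F : K -> set T).
Hypothesis (dF : trivIset [set: K] F).
Variable U : forall i, matroid (F i).
Let E := \bigcup_i F i.

Definition dsum_indep : set (set T) :=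
  [set I | I `<=` E /\ forall i, indep (U i) (I `&` F i)].

Let same i j x : F i x -> F j x -> i = j.
Proof. by move=> Fi Fj; apply: (dF (i := i) (j := j)) => //; exists x. Qed.

Lemma dsum_ground I : dsum_indep I -> I `<=` E.
Proof. by case. Qed.

Lemma dsum_set0 : dsum_indep set0.
Proof. by split=> [x//|i]; rewrite set0I; exact: indep_set0. Qed.

Lemma dsum_subset I J : dsum_indep J -> I `<=` J -> dsum_indep I.
Proof.
move=> [JE iJ] IJ; split=> [x /IJ /JE//|i].
by apply: indep_subset (iJ i) _; exact: setSI.
Qed.

Let glue I i L : dsum_indep I -> indep (U i) L ->
  dsum_indep ((I `\` F i) `|` L).
Proof.
move=> [IE iI] iL; have LF := indep_ground iL; split=> [x|j].
  by move=> [[/IE//]|/LF Fx]; exists i.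
have [eij|nij] := pselect (i = j).
  by subst j; apply: indep_subset iL _ => x [[[_ nF] Fx|//]].
apply: indep_subset (iI j) _ => x [[[Ix _] Fx//|/LF Fix Fjx]].
by case: nij; exact: same Fix Fjx.
Qed.

Let maxI I i : maximal_in dsum_indep I ->
  maximal_in (indep (U i)) (I `&` F i).
Proof.
move=> [dI mI]; split; first exact: (proj2 dI).
move=> L iL IL x Lx; split; last exact: indep_ground iL _ Lx.
apply: (mI _ (glue dI iL)); last by right.
move=> y Iy; have [Fy|nFy] := pselect (F i y); last by left.
by right; apply: IL.
Qed.

Lemma dsum_augment I J : dsum_indep I -> maximal_in dsum_indep J ->
  ~ maximal_in dsum_indep I ->
  exists e, (J `\` I) e /\ dsum_indep (I `|` [set e]).
Proof.
move=> dI mJ nI.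
have [L [x [[LE iL] IL Lx nIx]]] := not_maximal_in dI nI.
have [i _ Fix] := LE _ Lx.
have nIi : ~ maximal_in (indep (U i)) (I `&` F i).
  move=> [_ /(_ _ (iL i) (setSI IL))] h.
  by have [] : (I `&` F i) x by exact: h.
have [e [[[Je Fe] nIe] ie]] := indep_augment (proj2 dI i) (maxI i mJ) nIi.
exists e; split; first by split=> // Ie; apply: nIe.
apply: dsum_subset (glue dI ie) _ => y [Iy|->]; last by right; right.
by have [Fy|nFy] := pselect (F i y); [right; left|left].
Qed.

Lemma dsum_extend X I : X `<=` E -> dsum_indep I -> I `<=` X ->
  exists J, maximal_in [set L | dsum_indep L /\ L `<=` X] J /\ I `<=` J.
Proof.
move=> XE [IE iI] IX.
have /choice [J HJ] i : exists J, maximal_in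
    [set L | indep (U i) L /\ L `<=` X `&` F i] J /\ I `&` F i `<=` J.
  by apply: indep_extend; [exact: subIsetr|exact: iI|exact: setSI].
have JF i x : J i x -> X x /\ F i x by have [[[_ h] _] _] := HJ i; exact: h.
pose B := \bigcup_i J i.
have BF i : B `&` F i = J i.
  apply/seteqP; split=> x; last by move=> Jx; split; [exists i|case: (JF i x)].
  by move=> [[j _ Jx] Fx]; have [_ Fjx] := JF _ _ Jx; rewrite (same Fx Fjx).
have BX : B `<=` X by move=> x [i _ /JF []].
exists B; split; last first.
  move=> x Ix; have [i _ Fx] := IE _ Ix; exists i => //.
  by have [_] := HJ i; apply.
split.
  by split=> //; split=> [x /BX /XE//|i]; rewrite BF; have [[[]]] := HJ i.
move=> C [[CE iC] CX] BC x Cx; have [i _ Fx] := CE _ Cx.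
exists i => //; have [[_ mJ] _] := HJ i; apply: (mJ (C `&` F i)) => //.
  by split; [exact: iC|exact: setSI].
by rewrite -BF; exact: setSI.
Qed.

Definition direct_sum : matroid (\bigcup_i F i) := Matroid dsum_ground dsum_set0
  dsum_subset dsum_augment dsum_extend.

End DirectSum.

Lemma span_indep_choice (T : Type) (E : set T) (M : matroid E)
    (X B C : set T) (e : T) :
  maximal_in [set I | indep M I /\ I `<=` X] B ->
  maximal_in [set I | indep M I /\ I `<=` X] C ->
  ~ X e -> ~ indep M (B `|` [set e]) -> ~ indep M (C `|` [set e]).
Proof.
move=> [[iB BX] mB] [[iC CX] mC] nXe nBe iCe.
pose R := restrict M (X `|` [set e]).
have rC : indep R C by split=> // y /CX; left.
have bB : maximal_in (indep R) B.
  split; first by split=> // y /BX; left.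
  move=> D [iD DX] BD; apply: mB => //; split=> // y Dy.
  case: (DX y Dy) => // ye; case: nBe; apply: indep_subset iD _ => z [/BD//|->].
  by rewrite -ye.
have nC : ~ maximal_in (indep R) C.
  move=> [_ /(_ (C `|` [set e]))] h; apply: nXe; apply: (CX); apply: h.
  - by split=> // y [/CX|]; [left|right].
  - by move=> y; left.
  - by right.
have [f [[Bf nCf] [iCf _]]] := indep_augment rC bB nC.
apply: nCf; apply: (mC (C `|` [set f])); last by right.
- by split=> // y [/CX//|->]; exact: BX.
- by move=> y; left.
Qed.

(* Main.v *)
(** By uniformity, the elements of a class are interchangeable in N, so a set
    independent in both matroids can be enlarged, staying so, until every class
    is spanned either in M or in N.  Among the common independent sets spanning
    J in M, take K for which the set A of classes spanned in M is as large as
    possible.  By assumption A does not contain all classes, for otherwise K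
    would be a base of M; hence by induction the classes in A contain a common
    independent set B which spans all of them in N, and spans in M the part of
    K inside them.  Exchange this part of K for B, and enlarge the result to a
    set L spanning each class in M or in N.  As L spans K in M, by maximality
    it spans no class outside A in M, so it spans these in N; those in A are
    spanned in N by B. *)
Require Import Defs.
From mathcomp Require Import all_boot.
From mathcomp Require Import boolp classical_sets.

Local Open Scope classical_set_scope.

Set Implicit Arguments.
Unset Strict Implicit.
Unset Printing Implicit Defensive.

Section Span.
Variables (T : Type) (E : set T) (M : matroid E).
Implicit Types (B C I X Y : set T) (x : T).

Lemma base_restrict_extend X I : indep M I -> I `<=` X ->
  exists2 B, base (restrict M X) B & I `<=` B.
Proof.
move=> iI IX.
have [//|//|//|B [[[rB _] mB] IB]] := @indep_extend _ _ (restrict M X) X I.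
by exists B => //; split=> // C rC; apply: mB; split=> //; case: rC.
Qed.

Lemma base_restrict_insert X B x : base (restrict M X) B -> X x ->
  indep M (B `|` [set x]) -> B x.
Proof.
move=> [[_ BX] mB] Xx iBx; apply: (mB (B `|` [set x])); last by right.
- by split=> // y [/BX|->].
- exact: subsetUl.
Qed.

Lemma indep_base_restrict I : indep M I -> base (restrict M I) I.
Proof. by move=> iI; split=> [|C []//]; split. Qed.

Lemma spanP I x : indep M I -> E x ->
  span M I x <-> (indep M (I `|` [set x]) -> I x).
Proof.
move=> iI Ex; split=> [[//|[_ [B [[[_ BI] _] dBx]]]] iIx|Ix].
  by case: dBx; apply: indep_subset iIx _; exact: setSU.
have [|nIx] := pselect (I x); [by left|right].
split=> //; exists I; split; first exact: indep_base_restrict.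
by move=> /Ix.
Qed.

Lemma base_restrict_span X B : X `<=` E -> base (restrict M X) B ->
  X `<=` span M B.
Proof.
move=> XE bB x Xx; apply/spanP; [by case: bB => -[]|exact: XE|].
exact: base_restrict_insert bB Xx.
Qed.

Lemma indep_span_subset B C : indep M C -> B `<=` C -> C `&` span M B `<=` B.
Proof.
move=> iC BC x [Cx]; have iB := indep_subset iC BC.
move/(spanP iB (indep_ground iC Cx)); apply.
by apply: indep_subset iC _ => y [/BC|->].
Qed.

Lemma spanning_base B : indep M B -> E `<=` span M B -> base M B.
Proof.
move=> iB EB; split=> // C iC BC x Cx; apply: (indep_span_subset iC BC).
by split=> //; apply/EB/(indep_ground iC).
Qed.

Lemma spanning_base_restrict X B :
  indep M B -> B `<=` X -> X `<=` span M B -> base (restrict M X) B.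
Proof.
move=> iB BX XB; split=> // C [iC CX] BC x Cx.
by apply: (indep_span_subset iC BC); split=> //; exact/XB/CX.
Qed.

Lemma span_mono X Y : X `<=` Y -> span M X `<=` span M Y.
Proof.
move=> XY x [/XY|[[Ex _] [B [[[iB BX] _] dBx]]]]; first by left.
have [|nYx] := pselect (Y x); [by left|right; split=> //].
have [C bC BC] := base_restrict_extend iB (subset_trans BX XY).
exists C; split=> // iCx; apply: dBx.
by apply: indep_subset iCx _; exact: setSU.
Qed.

Lemma span_id X : span M (span M X) = span M X.
Proof.
apply/seteqP; split; last by move=> x; left.
have [B bB _] := base_restrict_extend (indep_set0 M) (@sub0set _ X).
have bsB : base (restrict M (span M X)) B.
  have [[iB BX] _] := bB; split; first by split=> // x /BX; left.
  move=> C [iC CX] BC x Cx.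
  have iBx : indep M (B `|` [set x]) by apply: indep_subset iC _ => y [/BC|->].
  case: (CX _ Cx) => [Xx|[[_ nXx] [D [mD dDx]]]].
    exact: base_restrict_insert bB Xx iBx.
  by case: (span_indep_choice mD bB nXx dDx iBx).
move=> x [//|[[Ex nsXx] [C [mC dCx]]]]; right; split.
  by split=> // Xx; apply: nsXx; left.
exists B; split=> //; exact: span_indep_choice mC bsB nsXx dCx.
Qed.

Lemma span_trans X Y : X `<=` span M Y -> span M X `<=` span M Y.
Proof. by move=> XY; rewrite -(span_id Y); exact: span_mono. Qed.

(* In the literature the elements of such a set are called clones. *)
Definition clonal X : Prop := forall I x y, X x -> X y -> ~ I x ->
  indep M (I `|` [set x]) -> indep M (I `|` [set y]).

Lemma clonal_span X I x : clonal X -> X `<=` E -> indep M I -> X x -> ~ I x ->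
  span M I x -> X `<=` span M I.
Proof.
move=> clX XE iI Xx nIx /(spanP iI (XE _ Xx)) dIx y Xy.
apply/spanP => //; first exact: XE.
move=> iIy; apply: contrapT => nIy; apply/nIx/dIx.
exact: clX iIy.
Qed.

Lemma uniform_clonal : uniform M -> clonal E.
Proof.
move=> unifM I x y Ex Ey nIx iIx.
have [Ixy|nIxy] := pselect ((I `|` [set x]) y).
  by apply: indep_subset iIx _ => z [Iz|->//]; left.
apply: indep_subset (unifM _ x y iIx _ _) _; [by right|by []|].
move=> z [Iz|->]; [left|by right].
by split; [left|move=> zx; apply: nIx; rewrite -zx].
Qed.

End Span.

Section DirectSum.
Variables (T K : Type) (F : K -> set T).
Hypothesis disjF : trivIset [set: K] F.
Variable U : forall i, matroid (F i).
Implicit Types (I J : set T) (S : set K).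

Local Notation N := (direct_sum disjF U).

Let same_class i j x : F i x -> F j x -> i = j.
Proof. by move=> Fi Fj; apply: (disjF (i := i) (j := j)) => //; exists x. Qed.

Lemma direct_sum_insert I i x : indep N I -> F i x ->
  indep (U i) ((I `&` F i) `|` [set x]) -> indep N (I `|` [set x]).
Proof.
move=> [IE iI] Fix iIx; split=> [y [/IE//|->]|j]; first by exists i.
have [eij|nij] := pselect (i = j).
  by subst j; apply: indep_subset iIx _ => y [[Iy|->] Fy]; [left; split|right].
apply: indep_subset (iI j) _ => y [[//|-> Fjx]].
by case: nij; exact: same_class Fix Fjx.
Qed.

Lemma direct_sum_clonal i : uniform (U i) -> clonal N (F i).
Proof.
move=> unifU I x y Fx Fy nIx NIx.
apply: (direct_sum_insert _ Fy).
  by apply: indep_subset NIx _; exact: subsetUl.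
apply: (uniform_clonal unifU Fx) => //; first by case.
apply: indep_subset (proj2 NIx i) _ => z [[Iz Fz]|->].
- by split=> //; left.
- by split=> //; right.
Qed.

Lemma direct_sum_glue S I J : indep N I -> indep N J ->
  I `<=` \bigcup_(i in S) F i ->
  indep N (I `|` (J `\` \bigcup_(i in S) F i)).
Proof.
move=> [IE iI] [JE iJ] IS; split=> [x [/IE|[/JE]]//|i].
have [Si|nSi] := pselect (S i).
  apply: indep_subset (iI i) _ => x [[//|[_ nSx]] Fx].
  by case: nSx; exists i.
apply: indep_subset (iJ i) _ => x [[/IS [j Sj Fjx]|[]//] Fx].
by case: nSi; rewrite (same_class Fx Fjx).
Qed.

End DirectSum.

Section Saturation.
Variables (T : Type) (E : set T) (M N : matroid E).
Implicit Types (A X J K : set T).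

Definition common_indep X J : Prop := [/\ indep M J, indep N J & J `<=` X].

Definition saturated K A : Prop := A `<=` span M K \/ A `<=` span N K.

Lemma saturated_mono J K A : J `<=` K -> saturated J A -> saturated K A.
Proof.
by move=> JK [] sA; [left|right]; apply: subset_trans sA _; exact: span_mono.
Qed.

Lemma saturate_clonal X A J : clonal N A -> A `<=` E -> A `<=` X ->
  common_indep X J ->
  exists K, [/\ common_indep X K, J `<=` K & saturated K A].
Proof.
move=> clA AE AX [iJ nJ JX].
have [Y bY JY] := base_restrict_extend iJ (@subsetUl _ J A).
have [K bK JK] := base_restrict_extend nJ JY.
have [[iY YJA] _] := bY; have [[nK KY] _] := bK.
exists K; split=> //.
  split=> //; first exact: indep_subset iY KY.
  by move=> x /KY /YJA [/JX|/AX].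
have [YK|/nonsubset [x [Yx nKx]]] := pselect (Y `<=` K); [left|right].
  apply: subset_trans (span_mono YK).
  apply: subset_trans (base_restrict_span _ bY); first exact: subsetUr.
  by rewrite subUset; split=> //; exact: indep_ground iJ.
have Ax : A x by case: (YJA _ Yx) => // /JK.
apply: clonal_span Ax nKx _ => //.
exact: base_restrict_span (indep_ground iY) bK _ Yx.
Qed.

Lemma saturate_family (I : eqType) (F : I -> set T) (s : seq I) X J :
  {in s, forall i, [/\ clonal N (F i), F i `<=` E & F i `<=` X]} ->
  common_indep X J ->
  exists K, [/\ common_indep X K, J `<=` K &
    {in s, forall i, saturated K (F i)}].
Proof.
move=> + cJ; elim: s => [|i s IHs] Fs; first by exists J; split.
have [|K [cK JK sK]] := IHs.
  by move=> j js; apply: Fs; rewrite inE js orbT.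
have [clFi FiE FiX] := Fs i (mem_head i s).
have [L [cL KL sL]] := saturate_clonal clFi FiE FiX cK.
exists L; split=> //; first exact: subset_trans KL.
by move=> j; rewrite inE => /predU1P [->//|/sK]; exact: saturated_mono.
Qed.

End Saturation.

Section FiniteSumOfUniform.
Variables (T : Type) (I : finType) (F : I -> set T).
Hypothesis disjF : trivIset [set: I] F.
Variable U : forall i, matroid (F i).
Hypothesis unifU : forall i, uniform (U i).
Variable M : matroid (\bigcup_i F i).
Implicit Types (S A : {set I}) (B J K L : set T).

Local Notation N := (direct_sum disjF U).
Local Notation classes S := (\bigcup_(i in [set` S]) F i).

Lemma exchange_classes A S J B : A \subset S ->
  common_indep M N (classes S) J -> common_indep M N (classes A) B ->
  J `&` classes A `<=` span M B ->
  exists K, [/\ common_indep M N (classes S) K, B `<=` K & J `<=` span M K].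
Proof.
move=> AS [iJ nJ JS] [iB nB BA] sB.
have [K bK BK] := base_restrict_extend iB (@subsetUl _ B (J `\` classes A)).
have [[iK KX] _] := bK.
have XN := direct_sum_glue nB nJ BA.
exists K; split=> //.
  split=> //; first exact: indep_subset XN KX.
  move=> x /KX [/BA [i Ai Fx]|[/JS//]].
  by exists i => //; exact: (fintype.subsetP AS).
move=> x Jx; have [Ax|nAx] := pselect (classes A x).
  by apply: (span_mono BK); exact: sB.
by apply: (base_restrict_span (indep_ground XN) bK); right.
Qed.

Definition spanned_classes S K : {set I} :=
  [set i in S | `[< F i `<=` span M K >]]%SET.

Lemma spanned_classesP S K i :
  reflect (i \in S /\ F i `<=` span M K) (i \in spanned_classes S K).
Proof.
by rewrite finset.inE; apply: (iffP andP) => -[iS] /asboolP.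
Qed.

Lemma spanned_classes_sub S K : spanned_classes S K \subset S.
Proof. by apply/fintype.subsetP => i /spanned_classesP []. Qed.

Lemma spanned_classes_mono S J K : J `<=` span M K ->
  spanned_classes S J \subset spanned_classes S K.
Proof.
move=> JK; apply/fintype.subsetP => i /spanned_classesP [iS FiJ].
apply/spanned_classesP; split=> //.
exact: subset_trans FiJ (span_trans JK).
Qed.

Lemma exists_max_spanned_classes S J : common_indep M N (classes S) J ->
  exists K, [/\ common_indep M N (classes S) K, J `<=` span M K &
    forall L, common_indep M N (classes S) L -> K `<=` span M L ->
      spanned_classes S L = spanned_classes S K].
Proof.
move=> cJ.
pose P A := `[< exists K, [/\ common_indep M N (classes S) K, J `<=` span M K &
  spanned_classes S K = A] >].
have [|A /maxsetP [/asboolP [K [cK JK KA]] maxA]] := @ex_maxset _ P.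
  by exists (spanned_classes S J); apply/asboolP; exists J; split=> // x; left.
exists K; split=> // L cL KL; rewrite KA; apply: maxA.
  apply/asboolP; exists L; split=> //.
  exact: subset_trans JK (span_trans KL).
by rewrite -KA; exact: spanned_classes_mono.
Qed.

Hypothesis no_common_base : forall S B,
  base (restrict M (classes S)) B -> indep N B -> classes S = set0.

Lemma spanned_classes_proper S K : common_indep M N (classes S) K ->
  classes S !=set0 -> spanned_classes S K \proper S.
Proof.
move=> [iK nK KS] [x Sx]; rewrite properE spanned_classes_sub /=; apply/negP.
move=> /fintype.subsetP Sspanned; suff : set0 x by [].
rewrite -(@no_common_base S K) //.
apply: spanning_base_restrict => // y [i iS Fy].
by have /spanned_classesP [_] := Sspanned i iS; apply.
Qed.

Lemma exists_spanning_common_indep S J : common_indep M N (classes S) J ->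
  exists B, [/\ common_indep M N (classes S) B, classes S `<=` span N B &
    J `<=` span M B].
Proof.
have [m] := ubnP #|S|; elim: m S J => // m IHm S J /ltnSE leSm cJ.
have [S0|] := pselect (classes S !=set0); last first.
  move/nonemptyPn => S0; exists J; split=> //; last by move=> x; left.
  by rewrite S0; exact: sub0set.
have [K [cK JK maxK]] := exists_max_spanned_classes cJ.
set A := spanned_classes S K in maxK.
have ltAS : (#|A| < #|S|)%N by exact/proper_card/spanned_classes_proper.
have [|B [cB AB KB]] := IHm A (K `&` classes A) (leq_trans ltAS leSm).
  case: cK => iK nK _; split; last exact: subIsetr.
  - by apply: indep_subset iK _; exact: subIsetl.
  - by apply: indep_subset nK _; exact: subIsetl.
have [B' [cB' BB' KB']] :=
  exchange_classes (spanned_classes_sub S K) cK cB KB.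
have [|L [cL B'L satL]] := @saturate_family _ _ M N _ F (enum S) _ _ _ cB'.
  move=> i; rewrite mem_enum => iS; split; last by move=> x; exists i.
  - exact: direct_sum_clonal.
  - by move=> x; exists i.
have KL : K `<=` span M L by exact: subset_trans KB' (span_mono B'L).
exists L; split=> //; last exact: subset_trans JK (span_trans KL).
move=> x [i iS Fx].
have [FiL|] := satL i (etrans (mem_enum _ _) iS); last exact.
apply: (span_mono (subset_trans BB' B'L)); apply: AB; exists i => //=.
by rewrite -(maxK L) //; exact/spanned_classesP.
Qed.

End FiniteSumOfUniform.

Theorem theorem3p6 (T : Type) (n : nat) (F : 'I_n -> set T)
    (disjF : trivIset [set: 'I_n] F)
    (U : forall i : 'I_n, matroid (F i))
    (unifU : forall i : 'I_n, uniform (U i))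
    (M : matroid (\bigcup_(i : 'I_n) F i))
    (noW : ~ exists W : set T,
      [/\ W !=set0,
          exists S : set 'I_n, W = \bigcup_(i in S) F i
        & exists B : set T,
            base (restrict M W) B /\ indep (direct_sum disjF U) B])
    (J : set T) (JM : indep M J) (JN : indep (direct_sum disjF U) J) :
  exists B : set T,
    [/\ base (direct_sum disjF U) B, indep M B & J `<=` span M B].
Proof.
have no_common_base (A : {set 'I_n}) B :
    base (restrict M (\bigcup_(i in [set` A]) F i)) B ->
    indep (direct_sum disjF U) B -> \bigcup_(i in [set` A]) F i = set0.
  move=> bB iB; apply/nonemptyPn => A0; apply: noW.
  by exists (\bigcup_(i in [set` A]) F i); split; [|exists [set` A]|exists B].
pose S := [set: 'I_n]%SET.
have ground_classes : \bigcup_i F i `<=` \bigcup_(i in [set` S]) F i.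
  by move=> x [i _ Fx]; exists i => //=; rewrite finset.in_setT.
have [|B [[iB nB _] sN sM]] :=
    exists_spanning_common_indep unifU no_common_base (S := S) (J := J).
  by split=> //; exact: subset_trans (indep_ground JM) ground_classes.
by exists B; split=> //; apply: spanning_base nB _; exact: subset_trans sN.
Qed.
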